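(* Let $\Bbbk$ be an algebraically closed field with $\operatorname{char}\Bbbk \neq 2,3$, and let $d, n$ be any positive integers. Then $(\mathbb{P}^n, \mathcal{O}_{\mathbb{P}^n}(d))$ satisfies property $\mathsf{QR}(3)$; that is, the homogeneous ideal of the $d$th Veronese variety $\nu_d(\mathbb{P}^n) \subset \mathbb{P}^N$, $N=\binom{n+d}{n}-1$, can be generated by quadrics of rank at most $3$.
   Context: $\mathbb{P}^n$ denotes projective space over $\Bbbk$. The rank of a quadric (homogeneous quadratic polynomial) over a field of characteristic $\neq 2$ is the rank of its associated symmetric matrix. A closed subscheme $X\subset \mathbb{P}^r$ satisfies property $\mathsf{QR}(k)$ if its homogeneous ideal $I(X)$ is generated by quadrics of rank at most $k$. For a very ample line bundle $L$ on a projective scheme $X$, $(X,L)$ satisfies property $\mathsf{QR}(k)$ if the linearly normal embedding $X\subset \mathbb{P}H^0(X,L)$ does. Here $\nu_d:\mathbb{P}^n\to\mathbb{P}^N$ is the embedding given by all monomials of degree $d$ (the zero ideal is regarded as generated by the empty set). *)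

(* Defs.v *)
From HB Require Import structures.
From mathcomp Require Import all_boot all_order all_algebra zify.
From mathcomp.multinomials Require Export mpoly.

Set Implicit Arguments.
Unset Strict Implicit.
Unset Printing Implicit Defensive.

Import GRing.Theory.
Local Open Scope ring_scope.

Section Ideals.
Variables (k : fieldType) (m : nat).
Implicit Types (S : {mpoly k[m]} -> Prop) (f q : {mpoly k[m]}).

Definition ideal_gen S f : Prop :=
  exists s : seq ({mpoly k[m]} * {mpoly k[m]}),
    (forall c, c \in s -> S c.2) /\ f = \sum_(c <- s) c.1 * c.2.

(* Off the diagonal, the coefficient of 'X_i * 'X_j is shared between the
   entries (i, j) and (j, i). *)
Definition quadric_mx q : 'M[k]_m :=
  \matrix_(i, j) (if i == j then q@_(U_(i) + U_(j))
                  else q@_(U_(i) + U_(j)) / 2%:R).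

Definition quadric_rank q : nat := \rank (quadric_mx q).

End Ideals.

Section Projective.
Variables (k : fieldType) (r : nat).

(* A subset of P^r is given by the predicate, on vectors of k^(r+1), of being
   a vector of homogeneous coordinates of one of its points. *)
Implicit Type X : 'rV[k]_r.+1 -> Prop.

(* For k algebraically closed and X closed, this is the (saturated) homogeneous
   ideal of X with its reduced scheme structure. *)
Definition homog_ideal X : {mpoly k[r.+1]} -> Prop :=
  ideal_gen (fun f => (exists e, f \is e.-homog) /\
                      (forall x, X x -> f.@[x 0] = 0)).

Definition QR (b : nat) X : Prop :=
  exists S : {mpoly k[r.+1]} -> Prop,
    (forall q, S q -> q \is 2.-homog /\ (quadric_rank q <= b)%N) /\
    (forall f, homog_ideal X f <-> ideal_gen S f).

End Projective.

(* The degree d monomials in n variables: [basis n d] is the library's set of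
   nondecreasing d-tuples of variable indices, and [s2m] maps such a tuple to
   the product of its variables. *)
Definition monomials (n d : nat) : seq 'X_{1..n} :=
  [seq s2m t | t : d.-tuple 'I_n <- enum (basis n d)].

Definition veronese_dim (n d : nat) : nat := 'C(n + d, n).-1.

Section Veronese.
Variables (k : fieldType) (n d : nat).

Definition veronese (x : 'rV[k]_n.+1) : 'rV[k]_(veronese_dim n d).+1 :=
  \row_j 'X_[nth 0%MM (monomials n.+1 d) j].@[x 0].

Definition veronese_variety (y : 'rV[k]_(veronese_dim n d).+1) : Prop :=
  exists x : 'rV[k]_n.+1, x != 0 /\
    exists c : k, c != 0 /\ y = c *: veronese x.

End Veronese.

Arguments veronese {k n} d x.
Arguments veronese_variety k n d y : clear implicits.

Lemma mem_monomials (n d : nat) (m : 'X_{1..n}) :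
  (m \in monomials n d) = (mdeg m == d).
Proof. by rewrite basis_cover. Qed.

Lemma uniq_monomials (n d : nat) : uniq (monomials n d).
Proof. exact: uniq_basis. Qed.

Lemma size_monomials (n d : nat) :
  size (monomials n.+1 d) = (veronese_dim n d).+1.
Proof.
rewrite size_basis /veronese_dim prednK ?bin_gt0 ?leq_addr//.
by rewrite addnC -(bin_sub (leq_addr d n)) addKn.
Qed.

Lemma tr_quadric_mx (k : fieldType) (m : nat) (q : {mpoly k[m]}) :
  (quadric_mx q)^T = quadric_mx q.
Proof. by apply/matrixP=> i j; rewrite !mxE eq_sym addmC. Qed.

Lemma quadric_mxE (k : fieldType) (m : nat) (q : {mpoly k[m]}) :
  2%:R != 0 :> k -> q \is 2.-homog ->
  q = \sum_i \sum_j quadric_mx q i j *: ('X_i * 'X_j).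
Proof.
move=> nz2 hq; apply/mpolyP => mm.
have co i j : (quadric_mx q i j *: ('X_i * 'X_j))@_mm =
              quadric_mx q i j * (U_(i) + U_(j) == mm)%MM%:R.
  by rewrite -mpolyXD mcoeffZ mcoeffX.
rewrite raddf_sum /=.
under eq_bigr => i _ do [rewrite raddf_sum /=; under eq_bigr => j _ do rewrite co].
have [/eqP dm|dm] := boolP (mdeg mm == 2); last first.
  rewrite (dhomog_nemf_coeff hq dm) big1// => i _; rewrite big1// => j _.
  case: eqP => [e|_]; last by rewrite mulr0.
  by move: dm; rewrite -e mdegD !mdeg1.
have [a [b ->]] : exists a b, mm = (U_(a) + U_(b))%MM.
  have : mm \in monomials m 2 by rewrite mem_monomials dm.
  case/mapP => t _ ->; exists (tnth t 0), (tnth t 1); apply/mnmP => i.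
  by rewrite mnmDE !mnm1E mnmE; case: t => -[|x [|y []]]//= ?; rewrite addn0 /tnth.
have eqU i j : ((U_(i) + U_(j))%MM == (U_(a) + U_(b))%MM :> 'X_{1..m}) =
    ((i == a) && (j == b)) || ((i == b) && (j == a)).
  apply/eqP/orP => [/mnmP e|[]/andP[/eqP-> /eqP->]//]; last by rewrite addmC.
  move: (e i) (e j) (e a) (e b); rewrite !mnmDE !mnm1E !eqxx.
  rewrite ![a == _]eq_sym ![b == _]eq_sym [j == i]eq_sym.
  case: (i == a); case: (j == b); case: (i == b); case: (j == a) => /=;
    rewrite ?eqxx; try (by left); try (by right);
    by case: (i == j); case: (a == b); case: (b == a); lia.
have [eab|nab] := eqVneq a b.
  rewrite -{}eab in eqU *.
  rewrite (bigD1 a)//= (bigD1 a)//= eqU eqxx mulr1 mxE eqxx.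
  rewrite !big1 ?addr0// => [i|i] ia; first rewrite big1// => j _;
  by rewrite eqU (negbTE ia) ?andbF mulr0.
have nba : b != a by rewrite eq_sym.
rewrite (bigD1 a)//= (bigD1 b nba)//= [X in _ + (_ + X)]big1 ?addr0; last first.
  by move=> i /andP[ia ib]; rewrite big1// => j _;
    rewrite eqU (negbTE ia) (negbTE ib) mulr0.
rewrite (bigD1 b)//= big1 ?addr0; last first.
  by move=> j jb; rewrite eqU (negbTE jb) (negbTE nab) andbF mulr0.
rewrite (bigD1 a)//= big1 ?addr0; last first.
  by move=> j ja; rewrite eqU (negbTE ja) (negbTE nba) andbF mulr0.
rewrite !eqU !eqxx orbT !mulr1 !mxE (negbTE nab) (negbTE nba) [(U_(b) + U_(a))%MM]addmC.
by rewrite -mulrDl; apply: (canRL (mulfK nz2)); rewrite mulr_natr mulr2n.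
Qed.

(* Main.v *)
Require Import Defs.
From mathcomp Require Import all_boot all_order all_algebra.
From mathcomp Require Import ring zify.
From HB Require Import structures.
Import GRing.Theory.
Local Open Scope ring_scope.

Set Implicit Arguments.
Unset Strict Implicit.
Unset Printing Implicit Defensive.

(** Write z_a for the coordinate of projective space indexed by a monomial x^a
    of degree d, and phi for the linear map sending x^a to z_a ([vform]). The
    quadrics phi(f^2 h) phi(g^2 h) - phi(f g h)^2, with f and g linear forms
    and h a form of degree d - 2, vanish on the Veronese variety and have rank
    at most 3, being of the shape A B - C^2 ([quadric_rank_le3]). They already
    generate the ideal; let J be the ideal generated by all quadrics of rank at
    most 3 that vanish on the variety.

    Polarizing in h, f and g ([polar_exchange]) replaces the squares by products
    of distinct factors. Put T(p, q) = phi(p h) phi(q h') + phi(p h') phi(q h).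
    For linear forms f, f', g, g' the three products T(ff', gg'), T(fg, f'g'),
    T(fg', f'g) are permuted by the symmetric group, and full polarization says
    that twice each of them is the sum of the other two modulo J. Subtracting
    two of these relations, 3 times the difference of any two of the products
    is in J, so the three are congruent. This is where the characteristic must
    not be 3.

    Next consider the exchange of x_i and x_l between two monomials,
      D(t, t') = z_(t x_i) z_(t' x_l) - z_(t x_l) z_(t' x_i),
    with t and t' of degree d - 1. The congruence of the products, read for the
    four variables x_i, x_p, x_q, x_l, says exactly that
    D(h x_p, h' x_q) = D(h x_q, h' x_p) modulo J: trading one variable between
    t and t' does not change D. Trading all of them gives D(t, t') = D(t', t)
    ([exchange_swap]), whereas D(t', t) = - D(t, t') by definition. So D(t, t')
    is in J when the characteristic is not 2 ([exchange_in_ideal]).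

    Finally, two monomials in the z_a with the same degree and the same image
    x^u are linked by such exchanges ([monomial_congr]), and the kernel of
    z_a |-> x^a is spanned by differences of such monomials
    ([veronese_kernel]). As the field is infinite, the forms vanishing on the
    variety are those in this kernel ([veronese_idealP]). *)

(** * Generated ideals *)

Section IdealGen.
Variables (k : fieldType) (m : nat) (S : {mpoly k[m]} -> Prop).
Local Notation J := (ideal_gen S).

Lemma ideal_gen_sub q : S q -> J q.
Proof.
move=> Sq; exists [:: (1, q)]; split; last by rewrite big_seq1 mul1r.
by move=> c; rewrite inE => /eqP->.
Qed.

Lemma ideal_gen0 : J 0.
Proof. by exists [::]; split=> //; rewrite big_nil. Qed.

Lemma ideal_genD p q : J p -> J q -> J (p + q).
Proof.
move=> [s [Ss ->]] [t [St ->]]; exists (s ++ t); split; last by rewrite big_cat.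
by move=> c; rewrite mem_cat => /orP[/Ss|/St].
Qed.

Lemma ideal_genMl p q : J q -> J (p * q).
Proof.
move=> [s [Ss ->]]; exists [seq (p * c.1, c.2) | c <- s]; split.
  by move=> c /mapP[c' /Ss Sc' ->].
by rewrite big_map mulr_sumr; apply: eq_bigr => c _; rewrite mulrA.
Qed.

Lemma ideal_genZ c p : J p -> J (c *: p).
Proof. by rewrite -mul_mpolyC; exact: ideal_genMl. Qed.

Lemma ideal_genN p : J p -> J (- p).
Proof. by rewrite -scaleN1r; exact: ideal_genZ. Qed.

Lemma ideal_genB p q : J p -> J q -> J (p - q).
Proof. by move=> Jp /ideal_genN; exact: ideal_genD. Qed.

Lemma ideal_gen_sum (I : eqType) (r : seq I) (F : I -> {mpoly k[m]}) :
  (forall i, i \in r -> J (F i)) -> J (\sum_(i <- r) F i).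
Proof.
move=> JF; rewrite big_seq; elim/big_rec: _ => [|i p /JF JFi Jp].
  exact: ideal_gen0.
exact: ideal_genD.
Qed.

Lemma ideal_gen_natK l p : l%:R != 0 :> k -> J (p *+ l) -> J p.
Proof.
move=> nz /(@ideal_genZ l%:R^-1).
by rewrite -[p *+ l]scaler_nat scalerA mulVf// scale1r.
Qed.

End IdealGen.

Lemma ideal_gen_idem (k : fieldType) (m : nat) (S T : {mpoly k[m]} -> Prop) p :
  (forall q, T q -> ideal_gen S q) -> ideal_gen T p -> ideal_gen S p.
Proof.
move=> TS [s [Ts ->]]; apply: ideal_gen_sum => c /Ts /TS.
exact: ideal_genMl.
Qed.

(** * Polarization of the rank 3 quadrics *)

Section Polarization.
Variables (k : fieldType) (n m : nat).
Variables (phi : {linear {mpoly k[n]} -> {mpoly k[m]}}).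
Variables (S : {mpoly k[m]} -> Prop) (e c : nat).
Local Notation J := (ideal_gen S).

Hypotheses (nz2 : 2%:R != 0 :> k) (nz3 : 3%:R != 0 :> k).
Hypothesis quad : forall f g h,
  f \is e.-homog -> g \is e.-homog -> h \is c.-homog ->
  J (phi (f * f * h) * phi (g * g * h) - phi (f * g * h) * phi (f * g * h)).

Lemma polar_cofactor f g h h' :
  f \is e.-homog -> g \is e.-homog -> h \is c.-homog -> h' \is c.-homog ->
  J (phi (f * f * h) * phi (g * g * h') + phi (f * f * h') * phi (g * g * h)
     - (phi (f * g * h) * phi (f * g * h')) *+ 2).
Proof.
move=> hf hg hh hh'.
have := ideal_genB (ideal_genB (quad hf hg (dhomogD hh hh')) (quad hf hg hh))
  (quad hf hg hh').
by congr J; rewrite !mulrDr !raddfD /=; ring.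
Qed.

Lemma linear_sqrD f f' h : phi ((f + f') * (f + f') * h) =
  phi (f * f * h) + phi (f * f' * h) *+ 2 + phi (f' * f' * h).
Proof.
have -> : (f + f') * (f + f') * h = f * f * h + (f * f' * h) *+ 2 + f' * f' * h.
  by ring.
by rewrite raddfD [X in X + _]raddfD raddfMn.
Qed.

Lemma polar_left f f' g h h' :
  f \is e.-homog -> f' \is e.-homog -> g \is e.-homog ->
  h \is c.-homog -> h' \is c.-homog ->
  J (phi (f * f' * h) * phi (g * g * h') + phi (f * f' * h') * phi (g * g * h)
     - phi (f * g * h) * phi (f' * g * h')
     - phi (f' * g * h) * phi (f * g * h')).
Proof.
move=> hf hf' hg hh hh'; apply: (ideal_gen_natK nz2).
have := ideal_genB (ideal_genB (polar_cofactor (dhomogD hf hf') hg hh hh')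
  (polar_cofactor hf hg hh hh')) (polar_cofactor hf' hg hh hh').
by congr J; rewrite !linear_sqrD !mulrDl !raddfD /=; ring.
Qed.

(** The three products T are permuted by permuting f, f', g, g', so this one
    relation gives three. *)
Lemma polar_full f f' g g' h h' :
  f \is e.-homog -> f' \is e.-homog -> g \is e.-homog -> g' \is e.-homog ->
  h \is c.-homog -> h' \is c.-homog ->
  let T p q := phi (p * h) * phi (q * h') + phi (p * h') * phi (q * h) in
  J (T (f * f') (g * g') *+ 2 - T (f * g) (f' * g') - T (f * g') (f' * g)).
Proof.
move=> hf hf' hg hg' hh hh' /=.
have := ideal_genB (ideal_genB (polar_left hf hf' (dhomogD hg hg') hh hh')
  (polar_left hf hf' hg hh hh')) (polar_left hf hf' hg' hh hh').
by congr J; rewrite !linear_sqrD !mulrDr !mulrDl !raddfD /=; ring.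
Qed.

(** The relations 2 A - B - C and 2 B - A - C differ by 3 (A - B). *)
Lemma polar_exchange f f' g g' h h' :
  f \is e.-homog -> f' \is e.-homog -> g \is e.-homog -> g' \is e.-homog ->
  h \is c.-homog -> h' \is c.-homog ->
  J (phi (f * f' * h) * phi (g * g' * h')
     + phi (f * f' * h') * phi (g * g' * h)
     - phi (f * g * h) * phi (f' * g' * h')
     - phi (f * g * h') * phi (f' * g' * h)).
Proof.
move=> hf hf' hg hg' hh hh'; apply: (ideal_gen_natK nz3).
have := ideal_genB (polar_full hf hf' hg hg' hh hh')
  (polar_full hf hg hf' hg' hh hh').
by congr J; rewrite /= (mulrC g f'); ring.
Qed.

End Polarization.

(** * Rank of a quadric A B - C^2 *)

Section QuadricRank.
Variables (k : fieldType) (r : nat).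
Hypothesis nz2 : 2%:R != 0 :> k.
Implicit Types a b c : 'rV[k]_r.

Definition linform a : {mpoly k[r]} := \sum_j a 0 j *: 'X_j.

Lemma linform_homog a : linform a \is 1.-homog.
Proof. by apply: rpred_sum => j _; rewrite rpredZ// dhomogX /= mdeg1. Qed.

Lemma mderiv_linform a i : (linform a)^`M(i) = (a 0 i)%:MP.
Proof.
rewrite /linform raddf_sum /= (bigD1 i)//= big1 => [|j ji].
  rewrite mderivZ mderivX mnm1E eqxx scale1r -{1}[U_(i)%MM]add0m addmK.
  by rewrite mpolyX0 addr0 alg_mpolyC.
by rewrite mderivZ mderivX mnm1E (negbTE ji) scale0r scaler0.
Qed.

Lemma mcoeff_linform a j : (linform a)@_U_(j) = a 0 j.
Proof.
rewrite /linform raddf_sum /= (bigD1 j)//= big1 => [|i ij].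
  by rewrite mcoeffZ mcoeffXU eqxx mulr1 addr0.
by rewrite mcoeffZ mcoeffXU (negbTE ij) mulr0.
Qed.

(** The matrix of a quadric is half its Hessian: this treats diagonal and
    off-diagonal entries alike. *)
Lemma quadric_mx_mderiv (q : {mpoly k[r]}) i j :
  quadric_mx q i j = (q^`M(i))@_U_(j) / 2%:R.
Proof.
rewrite mxE mcoeff_mderiv mnm1E addmC eq_sym; case: eqP => _ //.
by rewrite -[X in _ = X / _]mulr_natr mulfK.
Qed.

(** The matrix of A B - C^2 is a sum of three matrices that are each a column
    times a row. *)
Lemma quadric_rank_le3 a b c :
  (quadric_rank (linform a * linform b - linform c * linform c) <= 3)%N.
Proof.
rewrite /quadric_rank; set Q := quadric_mx _.
have -> : Q = a^T *m (2%:R^-1 *: b) + b^T *m (2%:R^-1 *: a) + c^T *m - c.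
  apply/matrixP => i j; rewrite quadric_mx_mderiv mderivB !mderivM.
  rewrite !mderiv_linform ![linform _ * _%:MP]mulrC.
  rewrite mcoeffB !mcoeffD !mcoeffCM !mcoeff_linform !mxE !big_ord1 !mxE.
  by field.
have rk1 (u v : 'rV[k]_r) : (\rank (u^T *m v) <= 1)%N.
  exact: leq_trans (mxrankM_maxr _ _) (rank_leq_row _).
rewrite (leq_trans (mxrank_add _ _))// -[3%N]/(2 + 1)%N leq_add//.
by rewrite (leq_trans (mxrank_add _ _))// -[2%N]/(1 + 1)%N leq_add.
Qed.

End QuadricRank.

(** * Forms vanishing on the Veronese variety *)

Lemma meval_homogZ (k : comNzRingType) (r e : nat) (f : {mpoly k[r]}) c
    (v : 'I_r -> k) :
  f \is e.-homog -> f.@[fun i => c * v i] = c ^+ e * f.@[v].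
Proof.
move=> hf; rewrite !mevalE mulr_sumr; apply: eq_big_seq => m mf.
rewrite -(dhomog_mf hf mf) /= mdegE -prodrXr mulrCA; congr (_ * _).
by rewrite -big_split; apply: eq_bigr => i _; rewrite exprMn.
Qed.

Lemma base_expansion_inj (D n : nat) (m m' : 'I_n -> nat) :
  (forall i, m i < D)%N -> (forall i, m' i < D)%N ->
  (\sum_i m i * D ^ i = \sum_i m' i * D ^ i)%N -> m =1 m'.
Proof.
elim: n m m' => [|n IHn] m m' ltm ltm' e; first by case.
have D_gt0 : (0 < D)%N by exact: leq_ltn_trans (ltm 0).
have split_low (w : 'I_n.+1 -> nat) : (\sum_i w i * D ^ i =
    (\sum_(i < n) w (lift ord0 i) * D ^ i) * D + w ord0)%N.
  rewrite big_ord_recl muln1 addnC; congr (_ + _)%N.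
  by rewrite big_distrl /=; apply: eq_bigr => i _; rewrite expnSr mulnA.
move: e; rewrite !split_low => e.
have e0 : m ord0 = m' ord0.
  by have /(congr1 (modn^~ D)) := e; rewrite !modnMDl !modn_small.
move: e; rewrite e0 => /addIn/eqP; rewrite eqn_pmul2r// => /eqP e i.
case: (unliftP ord0 i) => [j ->|-> //].
by apply: (IHn (m \o lift ord0) (m' \o lift ord0)) => // l /=.
Qed.

(** Kronecker substitution: for D larger than all the exponents of f, putting
    x_i = t^(D^i) turns distinct monomials of f into distinct powers of t, so
    that the one variable case applies. *)
Lemma mpoly_vanish (k : closedFieldType) (r : nat) (f : {mpoly k[r]}) :
  (forall v, f.@[v] = 0) -> f = 0.
Proof.
move=> f0; pose D := msize f; pose wt (m : 'X_{1..r}) := (\sum_i m i * D ^ i)%N.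
pose p : {poly k} := \sum_(m <- msupp f) f@_m *: 'X^(wt m).
have p0 : p = 0.
  apply/eqP; apply: contraT => /closed_nonrootP[x].
  case/eqP; rewrite -(f0 (fun i => x ^+ (D ^ i))) horner_sum mevalE.
  apply: eq_bigr => m _.
  rewrite hornerZ hornerXn -prodrXr; congr (_ * _).
  by apply: eq_bigr => i _; rewrite -exprM mulnC.
have ltD m i : m \in msupp f -> (m i < D)%N.
  move/msize_mdeg_lt; apply: leq_ltn_trans.
  by rewrite mdegE (bigD1 i)//= leq_addr.
apply/mpolyP => m; rewrite mcoeff0; apply/eqP; apply: contraT.
rewrite -mcoeff_msupp => mf; have /(congr1 (fun q : {poly k} => q`_(wt m))) := p0.
rewrite coef0 coef_sum (bigD1_seq m)//= ?msupp_uniq//.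
rewrite big_seq_cond big1 => [|m' /andP[m'f m'm]].
  move/eqP; rewrite coefZ coefXn eqxx mulr1 addr0.
  by rewrite mcoeff_eq0 mf.
rewrite coefZ coefXn; case: eqP => [e|_]; last by rewrite mulr0.
case/eqP: m'm; apply/mnmP; apply: (@base_expansion_inj D) => //.
- by move=> i; exact: ltD.
- by move=> i; exact: ltD.
Qed.

Section VeroneseForms.
Variables (k : fieldType) (n d : nat).
Local Notation N := (veronese_dim n d).+1.

Definition vmon (j : 'I_N) : 'X_{1..n.+1} := nth 0%MM (monomials n.+1 d) j.

Lemma mdeg_vmon j : mdeg (vmon j) = d.
Proof.
by apply/eqP; rewrite -mem_monomials mem_nth// size_monomials.
Qed.

Lemma vmon_inj : injective vmon.
Proof.
move=> i j /eqP; rewrite nth_uniq ?size_monomials ?uniq_monomials//.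
by move/eqP/val_inj.
Qed.

Lemma vmonP m : mdeg m = d -> exists j, m = vmon j.
Proof.
move/eqP; rewrite -mem_monomials => mm.
have lt : (index m (monomials n.+1 d) < N)%N by rewrite -size_monomials index_mem.
by exists (Ordinal lt); rewrite /vmon nth_index.
Qed.

(** The linear form of the ambient space that restricts to F on the Veronese
    variety, for F of degree d. *)
Definition vform (F : {mpoly k[n.+1]}) : {mpoly k[N]} :=
  linform (\row_j F@_(vmon j)).

Lemma vformE F : vform F = \sum_j F@_(vmon j) *: 'X_j.
Proof. by apply: eq_bigr => j _; rewrite mxE. Qed.

Lemma vform_is_linear : linear vform.
Proof.
move=> c F G; rewrite !vformE scaler_sumr -big_split; apply: eq_bigr => j _.
by rewrite mcoeffD mcoeffZ scalerDl scalerA.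
Qed.

HB.instance Definition _ :=
  GRing.isLinear.Build k {mpoly k[n.+1]} {mpoly k[N]} _ vform vform_is_linear.

Lemma vformX j : vform 'X_[vmon j] = 'X_j.
Proof.
rewrite vformE (bigD1 j)//= big1 => [|i ij]; rewrite mcoeffX.
  by rewrite eqxx scale1r addr0.
by rewrite (inj_eq vmon_inj) eq_sym (negbTE ij) scale0r.
Qed.

Definition vmap : N.-tuple {mpoly k[n.+1]} := [tuple 'X_[vmon j] | j < N].

Lemma comp_vform F : F \is d.-homog -> vform F \mPo vmap = F.
Proof.
move=> hF; rewrite [in LHS](mpolyE F) [RHS]mpolyE.
rewrite (raddf_sum (vform : {linear _ -> _})) raddf_sum.
apply: eq_big_seq => m /(dhomog_mf hF)/vmonP[j ->].
by rewrite /= linearZ /= comp_mpolyZ vformX comp_mpolyXU -tnth_nth tnth_mktuple.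
Qed.

End VeroneseForms.

(** A homogeneous f vanishes on the cone over the image of the Veronese map as
    soon as it vanishes on the image; over an infinite field, vanishing there
    is the vanishing of the polynomial obtained by substitution. *)
Lemma veronese_idealP (k : closedFieldType) (n d e : nat)
    (f : {mpoly k[(veronese_dim n d).+1]}) : f \is e.-homog ->
  (forall y, veronese_variety k n d y -> f.@[y 0] = 0) <-> f \mPo vmap k n d = 0.
Proof.
move=> hf; have ev (x : 'rV[k]_n.+1) : (f \mPo vmap k n d).@[x 0] = f.@[veronese d x 0].
  by rewrite comp_mpoly_meval; apply: meval_eq => j; rewrite tnth_mktuple mxE.
split=> [fX|f0 y [x [_ [c [_ ->]]]]]; last first.
  have -> : f.@[(c *: veronese d x) 0] = f.@[fun i => c * veronese d x 0 i].
    by apply: meval_eq => i; rewrite mxE.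
  by rewrite (meval_homogZ _ _ hf) -ev f0 meval0 mulr0.
(* The origin is not covered by the hypothesis: multiplying by a coordinate
   gives a polynomial vanishing at every vector. *)
have /eqP : (f \mPo vmap k n d) * 'X_0 = 0.
  apply: mpoly_vanish => v; rewrite mevalM mevalXU.
  have [->|v0] := eqVneq (v 0) 0; first by rewrite mulr0.
  pose x := \row_i v i.
  have -> : (f \mPo vmap k n d).@[v] = (f \mPo vmap k n d).@[x 0].
    by apply: meval_eq => i; rewrite mxE.
  rewrite ev fX ?mul0r//; exists x; split.
    by apply: contraNneq v0 => /rowP/(_ 0); rewrite !mxE => ->.
  by exists 1; rewrite oner_neq0 scale1r.
by rewrite mulf_eq0 -[X in _ || X]msupp_eq0 msuppX orbF => /eqP.
Qed.

(** * Exchanging variables between monomials *)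

Lemma addmAC (n : nat) : right_commutative (@mnm_add n).
Proof. by move=> x y w; rewrite -!addmA (addmC y). Qed.

Lemma mnm_split (n : nat) (m : 'X_{1..n}) i :
  m i != 0%N -> exists m1, m = (m1 + U_(i))%MM.
Proof. by move=> mi; exists (m - U_(i))%MM; rewrite submK// lep1mP. Qed.

Lemma mdegS_split (n r : nat) (m : 'X_{1..n}) :
  mdeg m = r.+1 -> exists i m1, m = (m1 + U_(i))%MM /\ mdeg m1 = r.
Proof.
move=> dm; have [/existsP[i /mnm_split[m1 em]]|] := boolP [exists i, m i != 0%N].
  exists i, m1; split=> //; move: dm; rewrite em mdegD mdeg1 addn1.
  by case.
rewrite negb_exists => /forallP m0; move: dm; rewrite mdegE big1// => i _.
by apply/eqP; rewrite -[_ == _]negbK.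
Qed.

Section Exchange.
Variables (k : fieldType) (n d : nat).
Local Notation N := (veronese_dim n d).+1.
Variable S : {mpoly k[N]} -> Prop.
Local Notation J := (ideal_gen S).

Hypotheses (nz2 : 2%:R != 0 :> k) (nz3 : 3%:R != 0 :> k).
Hypothesis quad : forall c (f g h : {mpoly k[n.+1]}), (c + 2)%N = d ->
  f \is 1.-homog -> g \is 1.-homog -> h \is c.-homog ->
  J (vform d (f * f * h) * vform d (g * g * h)
     - vform d (f * g * h) * vform d (f * g * h)).

Local Notation z m := (vform d 'X_[k, m]).

Definition exchange i l (t t' : 'X_{1..n.+1}) : {mpoly k[N]} :=
  z (t + U_(i)) * z (t' + U_(l)) - z (t + U_(l)) * z (t' + U_(i)).

(** This is the congruence T(x_i x_p, x_q x_l) = T(x_i x_q, x_p x_l) with its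
    four terms regrouped. *)
Lemma exchange_swap1 i l p q h h' :
  (mdeg h + 2)%N = d -> mdeg h' = mdeg h ->
  J (exchange i l (h + U_(p)) (h' + U_(q))
     - exchange i l (h + U_(q)) (h' + U_(p))).
Proof.
move=> dh dh'.
have hX j : ('X_j : {mpoly k[n.+1]}) \is 1.-homog by rewrite dhomogX /= mdeg1.
have hh : ('X_[h] : {mpoly k[n.+1]}) \is (mdeg h).-homog by rewrite dhomogX.
have hh' : ('X_[h'] : {mpoly k[n.+1]}) \is (mdeg h).-homog.
  by rewrite dhomogX /= dh'.
have := @polar_exchange _ _ _ (vform d : {linear _ -> _}) S 1 (mdeg h) nz2 nz3
  (fun f g e => quad dh) _ _ _ _ _ _ (hX i) (hX p) (hX q) (hX l) hh hh'.
rewrite /= -!mpolyXD; congr J; rewrite /exchange.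
have perm (x y w : 'X_{1..n.+1}) : (x + y + w = w + y + x)%MM.
  by rewrite addmC (addmC x) addmA.
have perm' (x y w : 'X_{1..n.+1}) : (x + y + w = w + x + y)%MM.
  by rewrite addmC addmA.
rewrite !(perm U_(i)%MM) (perm' U_(q)%MM) (perm' U_(q)%MM).
by rewrite !(perm' U_(p)%MM); ring.
Qed.

(** The factors of s and s' are traded one pair at a time; u and u' collect the
    pairs already traded. *)
Lemma exchange_swap i l r u u' s s' :
  mdeg s = r -> mdeg s' = r -> mdeg u' = mdeg u -> (mdeg u + r).+1 = d ->
  J (exchange i l (u + s) (u' + s') - exchange i l (u + s') (u' + s)).
Proof.
elim: r u u' s s' => [|r IHr] u u' s s' ds ds' du dd.
  move/eqP: ds ds'; rewrite mdeg_eq0 => /eqP-> /eqP; rewrite mdeg_eq0 => /eqP->.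
  by rewrite subrr; exact: ideal_gen0.
have [p [s1 [-> ds1]]] := mdegS_split ds.
have [q [s1' [-> ds1']]] := mdegS_split ds'.
have d1 : (mdeg (u + s1)%MM + 2)%N = d by rewrite mdegD ds1; lia.
have d2 : mdeg (u' + s1')%MM = mdeg (u + s1)%MM by rewrite !mdegD ds1 ds1' du.
have step1 := exchange_swap1 i l p q d1 d2.
have step2 : J (exchange i l (u + U_(q) + s1) (u' + U_(p) + s1')
                - exchange i l (u + U_(q) + s1') (u' + U_(p) + s1)).
  by apply: IHr => //; rewrite !mdegD !mdeg1 ?du//; lia.
have := ideal_genD step1 step2; congr J.
by rewrite !addmA !(addmAC _ U_(q)%MM) !(addmAC _ U_(p)%MM) addrA subrK.
Qed.

(** With u = u' = 0, [exchange_swap] compares the exchange for (t, t') with the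
    one for (t', t), which is its opposite. *)
Lemma exchange_in_ideal i l t t' : (mdeg t).+1 = d -> mdeg t' = mdeg t ->
  J (exchange i l t t').
Proof.
move=> dt dt'; apply: (ideal_gen_natK nz2).
have := @exchange_swap i l (mdeg t) 0%MM 0%MM t t' erefl dt' erefl.
rewrite mdeg0 add0n => /(_ dt); congr J; rewrite !add0m /exchange.
by ring.
Qed.

Definition zprod (s : seq 'X_{1..n.+1}) : {mpoly k[N]} := \prod_(m <- s) z m.

(** If b is not a, some variable x_i is missing in a and some x_l is in excess.
    Since b divides the whole product, x_i occurs in another factor a', and
    exchanging x_l in a with x_i in a' brings a closer to b, the distance being
    the degree of the part of b missing in a. *)
Lemma zprod_front (b a : 'X_{1..n.+1}) s :
  mdeg b = d -> mdeg a = d -> all (fun m => mdeg m == d) s ->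
  (b <= \sum_(m <- a :: s) m)%MM ->
  exists t, [/\ all (fun m => mdeg m == d) t, size t = size s,
    (\sum_(m <- a :: s) m = \sum_(m <- b :: t) m)%MM
    & J (zprod (a :: s) - zprod (b :: t))].
Proof.
move=> db; move e: (\sum_i (b i - a i))%N => w.
elim: w a s e => [|w IHw] a s e da ds le_b.
  have le_ba i : (b i <= a i)%N.
    by move: e => /eqP; rewrite sum_nat_eq0 => /forallP/(_ i); rewrite subn_eq0.
  have -> : a = b.
    have := submK (introT mnm_lepP le_ba) => ea.
    have : (mdeg (a - b) == 0)%N.
      by have := congr1 mdeg ea; rewrite mdegD da db => /eqP; lia.
    by rewrite mdeg_eq0 => /eqP ab0; rewrite -ea ab0 add0m.
  by exists s; split=> //; rewrite subrr; exact: ideal_gen0.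
have [i lt_ab] : exists i, (a i < b i)%N.
  apply/existsP; apply: contraT; rewrite negb_exists => /forallP le_ba.
  move: e; rewrite big1// => i _; apply/eqP; rewrite subn_eq0 leqNgt.
  exact: le_ba.
have [l lt_ba] : exists l, (b l < a l)%N.
  apply/existsP; apply: contraT; rewrite negb_exists => /forallP le_ab.
  have : (mdeg a < mdeg b)%N; last by rewrite da db ltnn.
  rewrite !mdegE (bigD1 i)//= [X in (_ < X)%N](bigD1 i)//= -addSn leq_add//.
  by apply: leq_sum => j _; rewrite leqNgt.
have [a' a's a'i] : exists2 a', a' \in s & a' i != 0%N.
  apply/hasP; apply: contraT => /hasPn s0.
  move/mnm_lepP/(_ i): le_b; rewrite big_cons mnmDE mnm_sumE big_seq big1.
    by rewrite addn0 leqNgt lt_ab.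
  by move=> m /s0; rewrite negbK => /eqP.
have [t' et'] := mnm_split a'i.
have [|t et] := @mnm_split _ a l; first by rewrite -lt0n (leq_ltn_trans _ lt_ba).
have dt : (mdeg t).+1 = d by rewrite -da et mdegD mdeg1 addn1.
have da' : mdeg a' = d by apply/eqP/(allP ds).
have dt' : mdeg t' = mdeg t.
  by apply: succn_inj; rewrite dt -da' et' mdegD mdeg1 addn1.
have ps := perm_to_rem a's.
pose s0 := (t' + U_(l))%MM :: rem a' s.
have sumE : (\sum_(m <- a :: s) m = \sum_(m <- (t + U_(i))%MM :: s0) m)%MM.
  rewrite big_cons (perm_big _ ps) /= !big_cons /= !addmA; congr (_ + _)%MM.
  by rewrite et et'; apply/mnmP => j; rewrite !mnmDE; lia.
have [||||u [du su eu Ju]] := IHw (t + U_(i))%MM s0.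
(* The distance drops by one, at the index i; at l it stays zero. *)
- apply/eqP; rewrite -(eqn_add2r 1) [X in _ == X]addn1 -e.
  rewrite (bigD1 i)//= [X in _ == X](bigD1 i)//= addnAC; apply/eqP.
  congr (_ + _)%N.
    have := congr1 (fun m : 'X_{1..n.+1} => m i) et.
    rewrite !mnmDE !mnm1E eqxx; case: eqP => [eli|_] /=; last by lia.
    by move: lt_ba; rewrite eli; lia.
  apply: eq_bigr => j ji; rewrite et !mnmDE !mnm1E [i == j]eq_sym (negbTE ji).
  by case: eqP => [<-|//] /=; move: lt_ba; rewrite et mnmDE mnm1E eqxx; lia.
- by rewrite mdegD mdeg1 addn1.
- rewrite /= mdegD mdeg1 addn1 dt' dt eqxx /=.
  by apply/allP => m /mem_rem/(allP ds).
- by rewrite -sumE.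
exists u; split=> //.
- by rewrite su /= size_rem// prednK//; case: (s) a's.
- by rewrite sumE.
rewrite -(subrK (zprod ((t + U_(i))%MM :: s0)) (zprod (a :: s))) -addrA.
apply: ideal_genD => //.
have -> : zprod (a :: s) - zprod ((t + U_(i))%MM :: s0) =
    zprod (rem a' s) * exchange l i t t'.
  rewrite /zprod big_cons (perm_big _ ps) /= !big_cons /exchange -et -et'.
  by ring.
exact/ideal_genMl/exchange_in_ideal.
Qed.

Lemma zprod_congr s t :
  all (fun m => mdeg m == d) s -> all (fun m => mdeg m == d) t ->
  size s = size t -> (\sum_(m <- s) m = \sum_(m <- t) m)%MM ->
  J (zprod s - zprod t).
Proof.
elim: t s => [|b t IHt] [|a s] //=.
  by move=> *; rewrite subrr; exact: ideal_gen0.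
move=> /andP[/eqP da ds] /andP[/eqP db dt] [sz] sumE.
have [|u [du su eu Ju]] := zprod_front db da ds.
  by rewrite sumE big_cons; apply/mnm_lepP => i; rewrite mnmDE leq_addr.
rewrite -(subrK (zprod (b :: u)) (zprod (a :: s))) -addrA.
apply: ideal_genD => //.
have -> : zprod (b :: u) - zprod (b :: t) = z b * (zprod u - zprod t).
  by rewrite /zprod !big_cons mulrBr.
apply/ideal_genMl/IHt => //; first by rewrite su.
by move: sumE; rewrite eu !big_cons => /addmI.
Qed.

(** * The kernel of the substitution *)

Definition vexp (M : 'X_{1..N}) : 'X_{1..n.+1} := (\sum_(j <- m2s M) vmon j)%MM.

Lemma mpolyX_zprod M : 'X_[M] = zprod [seq vmon j | j <- m2s M].
Proof.
rewrite -[M in LHS]s2mK /zprod big_map; under eq_bigr do rewrite vformX.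
elim: (m2s M) => [|j s IHs]; first rewrite big_nil -mpolyX0.
  by congr 'X_[_]; apply/mnmP => i; rewrite !mnmE.
rewrite big_cons -IHs -mpolyXD; congr 'X_[_]; apply/mnmP => i.
by rewrite mnmDE mnm1E !mnmE.
Qed.

Lemma comp_mpolyX_vexp M : 'X_[M] \mPo vmap k n d = 'X_[vexp M].
Proof.
rewrite mpolyX_zprod /zprod big_map rmorph_prod /vexp.
rewrite -(big_map (@vmon n d) xpredT id) -mpolyX_prod big_map.
apply: eq_bigr => j _; rewrite /= comp_vform// dhomogX /=.
exact/eqP/mdeg_vmon.
Qed.

Lemma monomial_congr M M' : mdeg M = mdeg M' -> vexp M = vexp M' ->
  J ('X_[M] - 'X_[M']).
Proof.
move=> dM vM; rewrite !mpolyX_zprod; apply: zprod_congr.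
- by apply/allP => m /mapP[j _ ->]; rewrite mdeg_vmon.
- by apply/allP => m /mapP[j _ ->]; rewrite mdeg_vmon.
- by rewrite !size_map !size_m2s.
- by rewrite !big_map.
Qed.

(** The image of a monomial M0 of f must cancel against that of another
    monomial M1 of f, and subtracting a multiple of M0 - M1 removes M0 from the
    support without enlarging it. *)
Lemma veronese_kernel e f : f \is e.-homog -> f \mPo vmap k n d = 0 -> J f.
Proof.
move sz: (size (msupp f)) => w; elim/ltn_ind: w f sz => w IHw f sz hf f0.
have [->|nz] := eqVneq f 0; first exact: ideal_gen0.
have M0f := mlead_supp nz; set M0 := mlead f in M0f.
have [M1 /andP[M1f M10] vM] :
    exists2 M1, (M1 \in msupp f) && (M1 != M0) & vexp M1 = vexp M0.
  have [/hasP[M1 M1f /andP[ne /eqP vM]]|/hasPn noM] :=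
    boolP (has (fun M1 => (M1 != M0) && (vexp M1 == vexp M0)) (msupp f)).
    by exists M1 => //; rewrite M1f.
  have fE : f \mPo vmap k n d = \sum_(M <- msupp f) f@_M *: 'X_[vexp M].
    rewrite [in LHS](mpolyE f) raddf_sum; apply: eq_bigr => M _.
    by rewrite /= comp_mpolyZ comp_mpolyX_vexp.
  have := congr1 (mcoeff (vexp M0)) f0; rewrite mcoeff0 fE raddf_sum /=.
  rewrite (bigD1_seq M0)//= ?msupp_uniq// big_seq_cond big1.
    rewrite mcoeffZ mcoeffX eqxx mulr1 addr0.
    by move/eqP; rewrite mcoeff_eq0 M0f.
  move=> M /andP[Mf ne]; rewrite mcoeffZ mcoeffX.
  by have := noM _ Mf; rewrite ne /= => /negbTE->; rewrite mulr0.
have dM0 := dhomog_mf hf M0f; have dM1 := dhomog_mf hf M1f.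
pose g := f - f@_M0 *: ('X_[M0] - 'X_[M1]).
rewrite -(subrK (f@_M0 *: ('X_[M0] - 'X_[M1])) f).
apply: ideal_genD; last first.
  by apply/ideal_genZ/monomial_congr => //; rewrite [LHS]dM0 [RHS]dM1.
apply: (IHw (size (msupp g))) => //.
- rewrite -sz (perm_size (perm_to_rem M0f)) /= ltnS.
  apply: uniq_leq_size; first exact: msupp_uniq.
  move=> M; rewrite mem_rem_uniq ?msupp_uniq// inE.
  rewrite !mcoeff_msupp /g mcoeffB mcoeffZ mcoeffB !mcoeffX.
  have [->|_] := eqVneq M M0.
    by rewrite (negbTE M10) subr0 mulr1 subrr eqxx.
  rewrite sub0r.
  have [<- _|_] := eqVneq M1 M; first by rewrite -mcoeff_msupp.
  by rewrite oppr0 mulr0 subr0.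
- by rewrite rpredB// rpredZ// rpredB// dhomogX; apply/eqP.
- by rewrite /g comp_mpolyB comp_mpolyZ comp_mpolyB !comp_mpolyX_vexp vM f0 subrr
    scaler0 subr0.
Qed.

End Exchange.

Theorem theorem1p1 (k : closedFieldType) (d n : nat)
    (char2 : 2%N \notin [pchar k]) (char3 : 3%N \notin [pchar k])
    (d_gt0 : (0 < d)%N) (n_gt0 : (0 < n)%N) :
  QR 3 (veronese_variety k n d).
Proof.
have nz2 : 2%:R != 0 :> k by move: char2; rewrite inE.
have nz3 : 3%:R != 0 :> k by move: char3; rewrite inE.
exists (fun q => [/\ q \is 2.-homog, (quadric_rank q <= 3)%N &
  forall y, veronese_variety k n d y -> q.@[y 0] = 0]).
split=> [q [] //|f]; split; apply: ideal_gen_idem => {}f; last first.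
  by case=> hf _ f0; apply: ideal_gen_sub; split=> //; exists 2%N.
case=> -[e hf] /(veronese_idealP hf); apply: veronese_kernel hf => //.
move=> c g1 g2 h dE hg1 hg2 hh; apply: ideal_gen_sub.
have hV (F : {mpoly k[n.+1]}) : vform d F \is 1.-homog by exact: linform_homog.
have hg a b : a \is 1.-homog -> b \is 1.-homog -> a * b * h \is d.-homog.
  by move=> ha hb; rewrite -dE addnC; exact: dhomogM (dhomogM ha hb) hh.
have hQ : vform d (g1 * g1 * h) * vform d (g2 * g2 * h)
   - vform d (g1 * g2 * h) * vform d (g1 * g2 * h) \is 2.-homog.
  by rewrite rpredB// (dhomogM (hV _) (hV _)).
split=> //; first exact: quadric_rank_le3.
apply/(veronese_idealP hQ); rewrite comp_mpolyB !rmorphM /= !comp_vform ?hg//.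
by ring.
Qed.
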